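(* Let $\Omega$ be a Polish space and let $T\in\mathscr{L}(\mathscr{M}(\Omega))$ be an ultra Feller operator. Then $T$ is a kernel operator.
   Context: $\Omega$ is a Polish space with Borel $\sigma$-algebra $\mathscr{B}(\Omega)$. $\mathscr{M}(\Omega)$ is the Banach lattice of (finite) signed measures on $\mathscr{B}(\Omega)$ with the total variation norm, $B_b(\Omega)$ the space of bounded Borel-measurable real functions and $C_b(\Omega)$ the space of bounded continuous real functions on $\Omega$. $\mathscr{L}(\mathscr{M}(\Omega))$ denotes the bounded linear operators on $\mathscr{M}(\Omega)$. A Markovian transition kernel is a map $k:\Omega\times\mathscr{B}(\Omega)\to[0,\infty)$ such that $k(x,\cdot)$ is a probability measure for every $x\in\Omega$ and $k(\cdot,A)$ is measurable for every $A\in\mathscr{B}(\Omega)$. An operator $T\in\mathscr{L}(\mathscr{M}(\Omega))$ is Markovian if there is a Markovian transition kernel $k$ with $(T\mu)(A)=\int_\Omega k(x,A)\,\mathrm{d}\mu(x)$ for all $\mu\in\mathscr{M}(\Omega)$, $A\in\mathscr{B}(\Omega)$. In this case $T'$ denotes the restriction to $B_b(\Omega)$ of the norm adjoint $T^*$, i.e. $(T'f)(x)=\int_\Omega f(y)\,k(x,\mathrm{d}y)$. A Markovian operator $T$ is strong Feller if $T'f\in C_b(\Omega)$ for all $f\in B_b(\Omega)$; it is ultra Feller if, in addition, for every $c>0$ the family $\{T'f: f\in B_b(\Omega),\ |f|\le c\mathds{1}\}$ is equicontinuous (at every point of $\Omega$), where $\mathds{1}$ is the constant function one. Kernel operators: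 for Riesz spaces $E,F$ with $F$ order complete, $E^*_{\mathrm{oc}}$ denotes the order continuous linear functionals on $E$ and $E^*_{\mathrm{oc}}\otimes F$ the space of order continuous finite rank operators from $E$ to $F$. The regular operators from $E$ to $F$ (differences of positive operators) form an order complete Riesz space, and the elements of the band $(E^*_{\mathrm{oc}}\otimes F)^{\bot\bot}$ generated by $E^*_{\mathrm{oc}}\otimes F$ in it are called kernel operators. For $E=F=\mathscr{M}(\Omega)$, every bounded linear operator is regular and order continuous and $\mathscr{M}(\Omega)^*_{\mathrm{oc}}=\mathscr{M}(\Omega)^*$, so a kernel operator on $\mathscr{M}(\Omega)$ is an element of the band $(\mathscr{M}(\Omega)^*\otimes\mathscr{M}(\Omega))^{\bot\bot}$ in the order complete Banach lattice $\mathscr{L}(\mathscr{M}(\Omega))$ (with its natural ordering: $S\le T$ iff $S\mu\le T\mu$ for all $\mu\ge0$). *)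

(* Defs.v *)
From HB Require Import structures.
From mathcomp Require Import all_boot all_order all_algebra.
From mathcomp Require Import all_classical all_reals all_analysis.

Set Implicit Arguments.
Unset Strict Implicit.
Unset Printing Implicit Defensive.

Import Order.TTheory GRing.Theory Num.Theory.
Import numFieldNormedType.Exports.

Local Open Scope classical_set_scope.
Local Open Scope ring_scope.

Definition polish (R : realType) (X : topologicalType) : Prop :=
  (exists2 D : set X, countable D & dense D) /\
  exists dist : X -> X -> R,
    [/\ forall x y, dist x y = 0 <-> x = y,
        forall x y, dist x y = dist y x,
        forall x y z, dist x z <= dist x y + dist y z,
        forall x (A : set X),
          nbhs x A <-> exists2 e : R, 0 < e & [set y | dist x y < e] `<=` A &
        forall u : nat -> X,
          (forall e : R, 0 < e -> exists N, forall m n,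
             (N <= m)%N -> (N <= n)%N -> dist (u m) (u n) < e) ->
          exists x : X, u @ \oo --> x].

(* The carrier of a charge is a function on all sets, whose values outside the
   sigma-algebra are irrelevant.  They are required to be 0 here, so that
   equality of signed measures is Leibniz equality. *)
Section signed_measure.
Context (d : measure_display) (X : measurableType d) (R : realType).

Definition signed_measure_pred : {pred set X -> R} :=
  [pred mu | `[< [/\ mu set0 = 0,
                     semi_sigma_additive (EFin \o mu) &
                     forall A, ~ measurable A -> mu A = 0] >] ].

Record signed_measure := SignedMeasure {
  signed_measure_fun :> set X -> R;
  _ : signed_measure_fun \in signed_measure_pred }.

HB.instance Definition _ := [isSub for signed_measure_fun].
HB.instance Definition _ := [Choice of signed_measure by <:].

Lemma signed_measure_submod : submod_closed signed_measure_pred.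
Proof.
split=> [|a mu nu].
  apply/asboolP; split=> // F mF tF mUF /=.
  apply: cvg_near_cst; apply: nearW => n.
  by rewrite big1.
move=> /asboolP[mu0 muS muN] /asboolP[nu0 nuS nuN].
apply/asboolP; split.
- by rewrite !fctE mu0 nu0 scaler0 addr0.
- move=> F mF tF mUF.
  rewrite [X in X @ _ --> _](_ : _ = (fun n =>
      a%:E * (\sum_(0 <= i < n) (EFin \o mu) (F i)) +
      \sum_(0 <= i < n) (EFin \o nu) (F i))%E); last first.
    by apply/funext => n; rewrite !sumEFin -EFinM -EFinD mulr_sumr -big_split.
  rewrite [X in _ --> X](_ : _ = (a%:E * (EFin \o mu) (\bigcup_i F i) +
      (EFin \o nu) (\bigcup_i F i))%E) //.
  apply: cvgeD => //; last exact: nuS.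
  by apply: cvgeZl => //; exact: muS.
- by move=> A mA; rewrite !fctE muN// nuN// scaler0 addr0.
Qed.

HB.instance Definition _ :=
  GRing.isSubmodClosed.Build R (set X -> R) signed_measure_pred
    signed_measure_submod.
HB.instance Definition _ :=
  [SubChoice_isSubLmodule of signed_measure by <:].

Lemma signed_measureP (mu : signed_measure) :
  [/\ mu set0 = 0, semi_sigma_additive (EFin \o mu) &
      forall A, ~ measurable A -> mu A = 0].
Proof. by case: mu => mu /= /asboolP. Qed.

Lemma signed_measureD (mu nu : signed_measure) A :
  (mu + nu) A = mu A + nu A.
Proof. by []. Qed.

Lemma signed_measureZ (a : R) (mu : signed_measure) A :
  (a *: mu) A = a * mu A.
Proof. by []. Qed.

Definition charge_of (mu : signed_measure) : set X -> \bar R := EFin \o mu.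

HB.instance Definition _ (mu : signed_measure) :=
  isCharge.Build d X R (charge_of mu)
    (let: And3 mu0 _ _ := signed_measureP mu in congr1 EFin mu0)
    (fun A _ => isT)
    (let: And3 _ muS _ := signed_measureP mu in muS).

Definition signed_measure_le (mu nu : signed_measure) : bool :=
  `[< forall A, mu A <= nu A >].

Lemma signed_measure_le_refl : reflexive signed_measure_le.
Proof. by move=> mu; apply/asboolP. Qed.

Lemma signed_measure_le_anti : antisymmetric signed_measure_le.
Proof.
move=> mu nu /andP[/asboolP mn /asboolP nm]; apply/val_inj/funext => A.
by apply/eqP; rewrite eq_le mn nm.
Qed.

Lemma signed_measure_le_trans : transitive signed_measure_le.
Proof.
move=> nu mu la /asboolP mn /asboolP nl; apply/asboolP => A.
exact: le_trans (mn A) (nl A).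
Qed.

HB.instance Definition _ :=
  Order.Le_isPOrder.Build ring_display signed_measure
    signed_measure_le_refl signed_measure_le_anti signed_measure_le_trans.

(* A chosen Hahn decomposition; the Jordan parts and the total variation do not
   depend on the choice on measurable sets (Hahn_decomposition_uniq). *)
Definition hahn_sets (mu : signed_measure) : set X * set X :=
  xget (set0, set0) [set PN | hahn_decomposition (charge_of mu) PN.1 PN.2].

Lemma hahn_setsP (mu : signed_measure) :
  hahn_decomposition (charge_of mu) (hahn_sets mu).1 (hahn_sets mu).2.
Proof.
have [P [N PN]] := Hahn_decomposition (charge_of mu).
exact: (@xgetI _ _ [set PN | hahn_decomposition (charge_of mu) PN.1 PN.2]
  (P, N)).
Qed.

Definition pos_part (mu : signed_measure) : {measure set X -> \bar R} :=
  jordan_pos (hahn_setsP mu).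

Definition neg_part (mu : signed_measure) : {measure set X -> \bar R} :=
  jordan_neg (hahn_setsP mu).

Definition tv_norm (mu : signed_measure) : R :=
  fine (charge_variation (hahn_setsP mu) setT).

Lemma tv_normE (mu : signed_measure) :
  tv_norm mu = mu (hahn_sets mu).1 - mu (hahn_sets mu).2.
Proof.
have [[mP _] [mN _] _ _] := hahn_setsP mu.
rewrite /tv_norm /charge_variation /= jordan_posE jordan_negE.
rewrite cjordan_posE cjordan_negE /crestr0 !mem_set//= /crestr !setTI.
by [].
Qed.

Lemma le_tv_norm (mu : signed_measure) A B :
  measurable A -> measurable B -> A `&` B = set0 ->
  mu A - mu B <= tv_norm mu.
Proof.
move=> mA mB AB0; pose V := charge_variation (hahn_setsP mu).
have Vfin C : measurable C -> V C \is a fin_num by exact: fin_num_measure.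
have muV C : measurable C -> `|mu C| <= fine (V C).
  move=> mC; have := abse_charge_variation (hahn_setsP mu) mC.
  by rewrite -/V -[X in (_ <= X)%E -> _]fineK ?Vfin// abse_EFin lee_fin.
apply: (@le_trans _ _ (fine (V A) + fine (V B))).
  apply: lerD; first exact: le_trans (ler_norm _) (muV _ mA).
  by apply: le_trans (muV _ mB); rewrite -normrN ler_norm.
rewrite -fineD ?Vfin// -measureU// fine_le ?Vfin//; first exact: measurableU.
by apply: le_measure; rewrite ?inE//; exact: measurableU.
Qed.

Lemma tv_normD (mu nu : signed_measure) :
  tv_norm (mu + nu) <= tv_norm mu + tv_norm nu.
Proof.
have [[mP _] [mN _] _ PN0] := hahn_setsP (mu + nu).
rewrite [leLHS]tv_normE !signed_measureD opprD addrACA.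
by apply: lerD; exact: le_tv_norm.
Qed.

Lemma tv_norm_ge0 (mu : signed_measure) : 0 <= tv_norm mu.
Proof. by apply: fine_ge0; apply: measure_ge0. Qed.

Lemma tv_normZ (a : R) (mu : signed_measure) :
  tv_norm (a *: mu) = `|a| * tv_norm mu.
Proof.
have le b nu : tv_norm (b *: nu) <= `|b| * tv_norm nu.
  have [[mP _] [mN _] _ PN0] := hahn_setsP (b *: nu).
  rewrite [leLHS]tv_normE !signed_measureZ -mulrBr.
  have [b0|b0] := ger0P b; first by rewrite ler_wpM2l// le_tv_norm.
  rewrite mulNr -mulrN ler_wnM2l ?(ltW b0)//.
  by rewrite lerNl opprB le_tv_norm// setIC.
apply/eqP; rewrite eq_le le /=; have [->|a0] := eqVneq a 0.
  by rewrite normr0 mul0r tv_norm_ge0.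
rewrite -[in leLHS](scale1r mu) -(mulVf a0) -scalerA.
by rewrite (le_trans (ler_wpM2l _ (le _ _)))// normfV mulVKf// normr_eq0.
Qed.

Lemma tv_norm_eq0 (mu : signed_measure) :
  tv_norm mu = 0 -> mu = 0.
Proof.
move=> mu0; apply/val_inj/funext => A /=; have [_ _ muN] := signed_measureP mu.
have [mA|/muN //] := pselect (measurable A).
have := le_tv_norm mu mA measurable0 (setI0 A).
have := le_tv_norm mu measurable0 mA (set0I A).
have [-> _ _] := signed_measureP mu.
rewrite mu0 subr0 sub0r oppr_le0 => A0 A0'.
by apply/eqP; rewrite eq_le A0 A0'.
Qed.

HB.instance Definition _ := Lmodule_isNormed.Build R signed_measure
  tv_normD tv_normZ tv_norm_eq0.

End signed_measure.

Section bounded_linear.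
Context (R : realType).

Definition bounded_linear (E F : normedModType R) (f : E -> F) : Prop :=
  linear f /\ exists C : R, forall x, `|f x| <= C * `|x|.

End bounded_linear.

Section operators.
Context (d : measure_display) (X : measurableType d) (R : realType).
Local Notation M := (signed_measure X R).

Definition bounded_operator_pred : {pred M -> M} :=
  [pred T | `[< bounded_linear T >] ].

Record bounded_operator := BoundedOperator {
  bounded_operator_fun :> M -> M;
  _ : bounded_operator_fun \in bounded_operator_pred }.

HB.instance Definition _ := [isSub for bounded_operator_fun].
HB.instance Definition _ := [Choice of bounded_operator by <:].

Lemma bounded_operator_submod : submod_closed bounded_operator_pred.
Proof.
split=> [|a S T].
  apply/asboolP; split=> [a u v|]; first by rewrite scaler0 addr0.
  by exists 0 => x; rewrite normr0 mul0r.
move=> /asboolP[Slin [C SC]] /asboolP[Tlin [D TD]].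
apply/asboolP; split=> [b u v|].
  rewrite !fctE Slin Tlin !scalerDr !scalerA [a * b]mulrC addrACA.
  by rewrite -!scalerA.
exists (`|a| * C + D) => x; rewrite !fctE mulrDl.
apply: (le_trans (ler_normD _ _)); rewrite normrZ -mulrA.
by apply: lerD => //; rewrite ler_wpM2l.
Qed.

HB.instance Definition _ :=
  GRing.isSubmodClosed.Build R (M -> M) bounded_operator_pred
    bounded_operator_submod.
HB.instance Definition _ :=
  [SubChoice_isSubLmodule of bounded_operator by <:].

Lemma bounded_operatorP (T : bounded_operator) : bounded_linear T.
Proof. by case: T => T /= /asboolP. Qed.

Definition bounded_operator_le (S T : bounded_operator) : bool :=
  `[< forall mu : M, 0 <= mu -> S mu <= T mu >].

Lemma bounded_operator_le_refl : reflexive bounded_operator_le.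
Proof. by move=> T; apply/asboolP. Qed.

Lemma bounded_operator_le_trans : transitive bounded_operator_le.
Proof.
move=> T S U /asboolP ST /asboolP TU; apply/asboolP => mu mu0.
exact: le_trans (ST _ mu0) (TU _ mu0).
Qed.

Lemma signed_measure_jordan (mu : M) :
  exists mup mun : M, [/\ 0 <= mup, 0 <= mun & mu = mup - mun].
Proof.
pose f (n : {finite_measure set X -> \bar R}) (A : set X) : R :=
  if pselect (measurable A) then fine (n A) else 0.
have fP n : f n \in @signed_measure_pred _ X R.
  have fE A : measurable A -> (EFin \o f n) A = n A.
    move=> mA; rewrite /f /=; case: pselect => [?|//].
    by rewrite fineK// fin_num_measure.
  apply/asboolP; split.
  - by rewrite /f; case: pselect => [?|//]; rewrite measure0.
  - move=> F mF tF mUF; rewrite [X in _ --> X]fE//.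
    rewrite [X in X @ _ --> _](_ : _ = (fun m => \sum_(0 <= i < m) n (F i))%E).
      exact: measure_semi_sigma_additive.
    by apply/funext => m; apply: eq_bigr => i _; exact: fE.
  - by move=> A nmA; rewrite /f; case: pselect.
pose p := SignedMeasure (fP (jordan_pos (hahn_setsP mu))).
pose q := SignedMeasure (fP (jordan_neg (hahn_setsP mu))).
have f0 n A : 0 <= f n A.
  by rewrite /f; case: pselect => // mA; exact: fine_ge0.
exists p, q; split; [exact/asboolP/f0|exact/asboolP/f0|].
apply/val_inj/funext => A; have [_ _ muN] := signed_measureP mu.
rewrite [RHS](_ : _ = p A - q A)// /p /q /= /f.
case: pselect => [mA|nmA]; last by rewrite muN ?subr0.
have := jordan_decomp (hahn_setsP mu) mA.
rewrite /cadd /= cscaleN1 => h; rewrite -fineN -fineD ?fin_numN ?fin_num_measure//.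
by rewrite -h.
Qed.

Lemma bounded_operator_le_anti : antisymmetric bounded_operator_le.
Proof.
move=> S T /andP[/asboolP ST /asboolP TS]; apply/val_inj/funext => mu /=.
have [p [q [p0 q0 ->]]] := signed_measure_jordan mu.
have eqST nu : 0 <= nu -> S nu = T nu.
  by move=> nu0; apply/eqP; rewrite eq_le ST// TS.
have [Slin _] := bounded_operatorP S; have [Tlin _] := bounded_operatorP T.
by rewrite addrC -scaleN1r Slin Tlin !eqST.
Qed.

HB.instance Definition _ :=
  Order.Le_isPOrder.Build ring_display bounded_operator
    bounded_operator_le_refl bounded_operator_le_anti
    bounded_operator_le_trans.

End operators.

(* The lattice operations are expressed as least upper and greatest lower
   bounds with respect to the ordering; no lattice structure is presupposed. *)
Section bands.
Context (V : porderZmodType).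

Definition modulus (x a : V) : Prop := supremums [set x; - x] a.

Definition disjoint_elements (x y : V) : Prop :=
  exists a b : V, [/\ modulus x a, modulus y b & infimums [set a; b] 0].

Definition disjoint_complement (A : set V) : set V :=
  [set x | forall y, A y -> disjoint_elements x y].

End bands.

Section kernel_operators.
Context (d : measure_display) (X : measurableType d) (R : realType).
Local Notation M := (signed_measure X R).

(* The functionals range over the whole norm dual of M, all of whose elements
   are order continuous. *)
Definition finite_rank : set (bounded_operator X R) :=
  [set S | exists (n : nat) (phi : 'I_n -> M -> R^o) (nu : 'I_n -> M),
     (forall i, bounded_linear (phi i)) /\
     forall mu, S mu = \sum_(i < n) phi i mu *: nu i].

Definition kernel_operator (T : bounded_operator X R) : Prop :=
  disjoint_complement (disjoint_complement finite_rank) T.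

Definition induced_by (T : bounded_operator X R) (k : R.-pker X ~> X) : Prop :=
  forall (mu : M) (A : set X), measurable A ->
    ((T mu A)%:E =
      (\int[pos_part mu]_x k x A) - (\int[neg_part mu]_x k x A))%E.

Definition markovian (T : bounded_operator X R) : Prop :=
  exists k : R.-pker X ~> X, induced_by T k.

Definition bounded_measurable (f : X -> R) : Prop :=
  measurable_fun [set: X] f /\ exists c : R, forall x, `|f x| <= c.

Definition kernel_adjoint (k : R.-pker X ~> X) (f : X -> R) : X -> R :=
  fun x => \int[k x]_y f y.

End kernel_operators.

(* measurableType, hence borel, requires a pointed type: X is nonempty. *)
Definition borel (X : ptopologicalType) := g_sigma_algebraType (@open X).

Section feller.
Context (X : ptopologicalType) (R : realType).

Definition bounded_continuous (f : X -> R) : Prop :=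
  continuous f /\ exists c : R, forall x, `|f x| <= c.

Definition strong_feller_kernel (k : R.-pker (borel X) ~> (borel X)) : Prop :=
  forall f : borel X -> R,
    bounded_measurable f -> bounded_continuous (kernel_adjoint k f).

Definition ultra_feller_kernel (k : R.-pker (borel X) ~> (borel X)) : Prop :=
  strong_feller_kernel k /\
  forall c : R, 0 < c ->
    @equicontinuous X R _
      [set f : borel X -> R | bounded_measurable f /\ forall x, `|f x| <= c]
      (kernel_adjoint k).

(* The kernel inducing a Markovian operator T is unique on measurable sets
   (evaluate T at Dirac measures), so T' does not depend on its choice. *)
Definition strong_feller (T : bounded_operator (borel X) R) : Prop :=
  exists k, induced_by T k /\ strong_feller_kernel k.

Definition ultra_feller (T : bounded_operator (borel X) R) : Prop :=
  exists k, induced_by T k /\ ultra_feller_kernel k.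

End feller.

(* Main.v *)
Require Import Defs.
From HB Require Import structures.
From mathcomp Require Import all_boot all_order all_algebra.
From mathcomp Require Import all_classical all_reals all_analysis.
From mathcomp Require Import measurable_realfun.

(* Let U be a lower bound of T and |S|, where S is disjoint from all finite rank
   operators.  It suffices to find, for each positive mu, a finite rank F and a
   positive G with T <= F + G and G mu small: then U - G is a lower bound of F
   and |S|, so U <= G.
   To build F and G, let D be a dense sequence and let p_j x be the first D n
   with k(x, .) within t_j = O(2^-j) of k(D n, .) in variation.  Ultra Feller
   makes p_j defined everywhere and strong Feller makes it measurable.  Since
   k(p_j x, .) -> k(x, .),
     k(x, .) <= k(p_0 x, .) + \sum_j (k(p_{j+1} x, .) - k(p_j x, .))^+ .
   F keeps the part of k(p_0 x, .) with p_0 x among the first N terms of D; G is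
   given by the rest.  The kernel of G is measurable because it is a sum of
   functions of countably valued maps. *)

Set Implicit Arguments.
Unset Strict Implicit.
Unset Printing Implicit Defensive.

Import Order.TTheory GRing.Theory Num.Theory.
Import numFieldNormedType.Exports.

Local Open Scope classical_set_scope.
Local Open Scope ring_scope.

(** * Finite measures as signed measures, and Jordan parts *)

Section signed_measures.
Context (d : measure_display) (X : measurableType d) (R : realType).
Local Notation M := (signed_measure X R).
Implicit Types (m p q : {measure set X -> \bar R}) (mu nu : M) (A : set X).

Lemma signed_measure_leP mu nu : reflect (forall A, mu A <= nu A) (mu <= nu).
Proof. exact: asboolP. Qed.

Lemma signed_measureB mu nu A : (mu - nu) A = mu A - nu A.
Proof. by []. Qed.

Lemma signed_measure_eqP mu nu :
  (forall A, measurable A -> mu A = nu A) -> mu = nu.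
Proof.
move=> munu; apply/val_inj/funext => A /=.
have [mA|nmA] := pselect (measurable A); first exact: munu.
by have [_ _ ->//] := signed_measureP mu; have [_ _ ->//] := signed_measureP nu.
Qed.

(** Meaningful for finite [m]; [insubd 0] makes the map total. *)
Definition signed_of m : M :=
  insubd 0 (fun A => if pselect (measurable A) then fine (m A) else 0).

Lemma signed_ofE m A : (m setT < +oo)%E -> measurable A ->
  (signed_of m A)%:E = m A.
Proof.
move=> /lty_fin_num_fun mfin.
pose f A : R := if pselect (measurable A) then fine (m A) else 0.
have fE B : measurable B -> (EFin \o f) B = m B.
  by move=> mB; rewrite /f /=; case: pselect => // ?; rewrite fineK// mfin.
have fP : f \in @signed_measure_pred _ X R.
  apply/asboolP; split.
  - by rewrite /f; case: pselect => // ?; rewrite measure0.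
  - move=> F mF tF mUF; rewrite [X in _ --> X]fE//.
    rewrite [X in X @ _ --> _](_ : _ = (fun k => \sum_(0 <= i < k) m (F i))%E).
      exact: measure_semi_sigma_additive.
    by apply/funext => k; apply: eq_bigr => i _; exact: fE.
  - by move=> B nmB; rewrite /f; case: pselect.
move=> mA; rewrite -fE// /signed_of -/f.
by have -> : signed_measure_fun (insubd 0 f) = f by exact: insubdK.
Qed.

Lemma signed_of_ge0 m : (m setT < +oo)%E -> 0 <= signed_of m.
Proof.
move=> mfin; apply/signed_measure_leP => A; rewrite [leLHS](_ : _ = 0)//.
have [mA|nmA] := pselect (measurable A).
  by rewrite -lee_fin signed_ofE.
by have [_ _ ->//] := signed_measureP (signed_of m).
Qed.

Lemma tv_norm_pos_neg mu :
  (tv_norm mu)%:E = (pos_part mu setT + neg_part mu setT)%E.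
Proof. by rewrite /tv_norm fineK// fin_num_measure. Qed.

Lemma pos_neg_partE mu A : measurable A ->
  (mu A)%:E = (pos_part mu A - neg_part mu A)%E.
Proof.
move=> mA; have := jordan_decomp (hahn_setsP mu) mA.
by rewrite /cadd /= cscaleN1 => <-.
Qed.

Lemma pos_part_lty mu : (pos_part mu setT < +oo)%E.
Proof. by rewrite ltey_eq fin_num_measure. Qed.

Lemma neg_part_lty mu : (neg_part mu setT < +oo)%E.
Proof. by rewrite ltey_eq fin_num_measure. Qed.

Lemma ge0_neg_part mu A : 0 <= mu -> measurable A -> neg_part mu A = 0%E.
Proof.
move=> /signed_measure_leP mu0 mA; apply/eqP; rewrite eq_le measure_ge0 andbT.
have [_ [mN _] _ _] := hahn_setsP mu.
rewrite /neg_part /= jordan_negE cjordan_negE /crestr0 mem_set// /crestr /=.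
by rewrite lee_fin oppr_le0; exact: mu0.
Qed.

Lemma ge0_pos_part mu A : 0 <= mu -> measurable A -> pos_part mu A = (mu A)%:E.
Proof. by move=> mu0 mA; rewrite pos_neg_partE// ge0_neg_part// sube0. Qed.

Lemma ge0_tv_norm mu : 0 <= mu -> tv_norm mu = mu setT.
Proof.
move=> mu0; apply: EFin_inj.
by rewrite tv_norm_pos_neg ge0_neg_part// ge0_pos_part// adde0.
Qed.

(** Expresses the mass of a positive part as a value of [mu] on a single set. *)
Lemma pos_part_hahn mu A : measurable A ->
  pos_part mu A = (mu (A `&` (hahn_sets mu).1))%:E.
Proof.
move=> mA; have [[mP _] _ _ _] := hahn_setsP mu.
by rewrite /pos_part /= jordan_posE cjordan_posE /crestr0 mem_set.
Qed.

End signed_measures.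

(** * The bounded operator given by a measurable, uniformly bounded family of measures *)

Section integral_operator.
Context (d : measure_display) (X : measurableType d) (R : realType).
Local Notation M := (signed_measure X R).
Local Notation measure := {measure set X -> \bar R}.
Implicit Types (m p q : measure) (mu nu : M) (A : set X).
Variables (g : X -> measure) (C : R).
Hypothesis mg : forall A, measurable A -> measurable_fun setT (g ^~ A).
Hypothesis gC : forall x, (g x setT <= C%:E)%E.

(** Countable additivity is the exchange of the integral with a nonnegative series. *)
Lemma ex_mixture m :
  exists n : measure, forall A, n A = (\int[m]_x g x A)%E.
Proof.
pose f A := (\int[m]_x g x A)%E.
have f0 : f set0 = 0%E by rewrite /f integral0_eq// => x _; rewrite measure0.
have f_ge0 A : (0 <= f A)%E by exact: integral_ge0.
have f_add : semi_sigma_additive f.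
  move=> F mF tF mUF.
  have -> : f (\bigcup_n F n) = (\sum_(0 <= i <oo) f (F i))%E.
    rewrite -integral_nneseries//; last by move=> i; exact: mg.
    by apply: eq_integral => x _; rewrite measure_semi_bigcup.
  by apply: is_cvg_nneseries => i _ _; exact: f_ge0.
by exists (HB.pack_for measure f (isMeasure.Build _ _ _ f f0 f_ge0 f_add)).
Qed.

Definition mixture m : measure := projT1 (cid (ex_mixture m)).

Lemma mixtureE m A : mixture m A = (\int[m]_x g x A)%E.
Proof. exact: (projT2 (cid (ex_mixture m))). Qed.

Lemma mixture_le m : (mixture m setT <= C%:E * m setT)%E.
Proof.
rewrite mixtureE -integral_cst//; apply: ge0_le_integral => //=.
exact: mg.
Qed.

Lemma mixture_lty m : (m setT < +oo)%E -> (mixture m setT < +oo)%E.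
Proof.
move=> mfin; apply: le_lt_trans (mixture_le m) _.
by rewrite -(@fineK _ (m setT)) ?ltry// ge0_fin_numE.
Qed.

(* Naming the structures hides the reverse coercions that block rewriting with
   measure_addE. *)
Let add m p : measure := measure_add m p.

Let addE m p A : add m p A = (m A + p A)%E.
Proof. exact: measure_addE. Qed.

Let add_lty m p : (m setT < +oo)%E -> (p setT < +oo)%E ->
  (add m p setT < +oo)%E.
Proof. by move=> mfin pfin; rewrite addE lte_add_pinfty. Qed.

Let scale (a : {nonneg R}) m : measure := mscale a m.

Let scaleE a m A : scale a m A = (a%:num%:E * m A)%E.
Proof. by []. Qed.

Let scale_lty a m : (m setT < +oo)%E -> (scale a m setT < +oo)%E.
Proof.
by move=> mfin; rewrite scaleE -(@fineK _ (m setT)) ?ltry// ge0_fin_numE.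
Qed.

Lemma signed_of_mixtureD m p A : (m setT < +oo)%E -> (p setT < +oo)%E ->
  measurable A ->
  signed_of (mixture (add m p)) A =
  signed_of (mixture m) A + signed_of (mixture p) A.
Proof.
move=> mfin pfin mA; apply: EFin_inj.
rewrite EFinD !signed_ofE ?mixture_lty ?add_lty// !mixtureE.
by apply: ge0_integral_measure_add => //; exact: mg.
Qed.

Lemma signed_of_mixtureZ m (a : {nonneg R}) A : (m setT < +oo)%E ->
  measurable A ->
  signed_of (mixture (scale a m)) A = a%:num * signed_of (mixture m) A.
Proof.
move=> mfin mA; apply: EFin_inj.
rewrite EFinM !signed_ofE ?mixture_lty ?scale_lty// !mixtureE.
by apply: ge0_integral_mscale => //; exact: mg.
Qed.

Definition integral_op mu : M :=
  signed_of (mixture (pos_part mu)) - signed_of (mixture (neg_part mu)).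

(** Independence of the splitting: [p - q] and the Jordan parts represent the same [mu], so
    [p + neg_part mu] and [q + pos_part mu] agree on measurable sets, and hence so do their
    mixtures. *)
Lemma integral_opE mu p q A : (p setT < +oo)%E -> (q setT < +oo)%E ->
  (forall A, measurable A -> (mu A)%:E = (p A - q A)%E) -> measurable A ->
  integral_op mu A = signed_of (mixture p) A - signed_of (mixture q) A.
Proof.
move=> pfin qfin mupq mA; rewrite /integral_op signed_measureB.
apply/eqP; rewrite subr_eq addrAC eq_sym subr_eq; apply/eqP.
have Pfin := pos_part_lty mu; have Nfin := neg_part_lty mu.
rewrite -!signed_of_mixtureD//.
apply: EFin_inj; rewrite !signed_ofE ?mixture_lty ?add_lty//.
rewrite !mixtureE; apply: eq_measure_integral => B mB _.
rewrite !addE; have := mupq B mB; rewrite pos_neg_partE//.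
(* Finiteness turns the identity into one between reals, where terms can change sides. *)
have finB (n : measure) : (n setT < +oo)%E -> exists r, n B = r%:E.
  by move=> /lty_fin_num_fun /(_ _ mB) /fineK <-; exists (fine (n B)).
have [[? ->] [? ->]] := (finB _ pfin, finB _ qfin).
have [[? ->] [? ->]] := (finB _ Pfin, finB _ Nfin).
rewrite -!EFinB -!EFinD => -[/eqP]; rewrite subr_eq addrAC eq_sym subr_eq.
by move=> /eqP ->.
Qed.

(** The Jordan parts of a sum are in general not the sums of the Jordan parts. Linearity is
    therefore proved on arbitrary splittings, which are stable under sums and nonnegative
    multiples. *)
Definition splits mu p q := [/\ (p setT < +oo)%E, (q setT < +oo)%E &
  forall A, measurable A -> (mu A)%:E = (p A - q A)%E].

Lemma splits_pos_neg mu : splits mu (pos_part mu) (neg_part mu).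
Proof.
split; [exact: pos_part_lty|exact: neg_part_lty|exact: pos_neg_partE].
Qed.

Lemma splitsD mu nu p q p' q' : splits mu p q -> splits nu p' q' ->
  splits (mu + nu) (add p p') (add q q').
Proof.
move=> [pfin qfin mupq] [pfin' qfin' nupq]; split.
- exact: add_lty.
- exact: add_lty.
- move=> A mA; rewrite signed_measureD EFinD mupq// nupq// !addE.
  rewrite -(@fineK _ (p A)) ?lty_fin_num_fun//.
  rewrite -(@fineK _ (q A)) ?lty_fin_num_fun//.
  rewrite -(@fineK _ (p' A)) ?lty_fin_num_fun//.
  rewrite -(@fineK _ (q' A)) ?lty_fin_num_fun//.
  by rewrite -?(EFinB, EFinD) opprD addrACA.
Qed.

Lemma splitsZ mu p q (a : {nonneg R}) : splits mu p q ->
  splits (a%:num *: mu) (scale a p) (scale a q).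
Proof.
move=> [pfin qfin mupq]; split.
- exact: scale_lty.
- exact: scale_lty.
- move=> A mA; rewrite signed_measureZ EFinM mupq// !scaleE.
  rewrite -(@fineK _ (p A)) ?lty_fin_num_fun//.
  rewrite -(@fineK _ (q A)) ?lty_fin_num_fun//.
  by rewrite -?(EFinB, EFinM) mulrBr.
Qed.

Lemma integral_opD mu nu :
  integral_op (mu + nu) = integral_op mu + integral_op nu.
Proof.
have := splits_pos_neg nu; have := splits_pos_neg mu.
move: (pos_part mu) (neg_part mu) (pos_part nu) (neg_part nu).
move=> p q p' q' sm sn.
apply: signed_measure_eqP => A mA.
have [? ? smE] := sm; have [? ? snE] := sn; have [? ? smnE] := splitsD sm sn.
rewrite [RHS]signed_measureD (integral_opE _ _ smE)// (integral_opE _ _ snE)//.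
rewrite (integral_opE _ _ smnE)//.
rewrite (signed_of_mixtureD (m := p))// (signed_of_mixtureD (m := q))//.
by rewrite opprD addrACA.
Qed.

Lemma integral_opZ_ge0 mu (a : {nonneg R}) :
  integral_op (a%:num *: mu) = a%:num *: integral_op mu.
Proof.
have := splits_pos_neg mu.
move: (pos_part mu) (neg_part mu) => p q sm.
apply: signed_measure_eqP => A mA.
have [? ? smE] := sm; have [? ? saE] := splitsZ a sm.
rewrite [RHS]signed_measureZ (integral_opE _ _ smE)//.
rewrite (integral_opE _ _ saE)//.
rewrite (signed_of_mixtureZ (m := p))// (signed_of_mixtureZ (m := q))//.
by rewrite mulrBr.
Qed.

Lemma integral_op_linear : linear integral_op.
Proof.
move=> a mu nu; rewrite integral_opD; congr (_ + _).
have [a0|a0] := leP 0 a; first exact: integral_opZ_ge0 (NngNum a0).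
(* For negative [a], additivity reduces the claim to the scalar [- a]. *)
have na0 : 0 <= - a by rewrite oppr_ge0 ltW.
have op0 : integral_op 0 = 0.
  rewrite -[X in integral_op X](scale0r 0) (integral_opZ_ge0 _ 0%:nng).
  by rewrite scale0r.
have opN : integral_op (a *: mu) + integral_op (- a *: mu) = 0.
  by rewrite -integral_opD scaleNr subrr op0.
apply/eqP; rewrite -subr_eq0 -scaleNr -(integral_opZ_ge0 _ (NngNum na0)).
by rewrite opN.
Qed.

(** Each mixture is positive, so its norm is its total mass, at most [C] times that of the Jordan
    part; the masses of the two Jordan parts add up to the norm of [mu]. *)
Lemma integral_op_bounded mu : `|integral_op mu| <= C * `|mu|.
Proof.
have tv_mixture (m : measure) : (m setT < +oo)%E ->
    tv_norm (signed_of (mixture m)) <= C * fine (m setT).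
  move=> mfin; have Smfin := mixture_lty mfin.
  rewrite ge0_tv_norm ?signed_of_ge0// -lee_fin signed_ofE// EFinM.
  by rewrite fineK ?mixture_le// ge0_fin_numE.
have Pfin := pos_part_lty mu; have Nfin := neg_part_lty mu.
apply: le_trans (ler_normB _ _) _.
apply: le_trans (lerD (tv_mixture _ Pfin) (tv_mixture _ Nfin)) _.
by rewrite -mulrDr -fineD ?ge0_fin_numE// -tv_norm_pos_neg.
Qed.

Lemma integral_op_subproof :
  integral_op \in @bounded_operator_pred d X R.
Proof.
apply/asboolP; split; first exact: integral_op_linear.
by exists C; exact: integral_op_bounded.
Qed.

Definition integral_operator : bounded_operator X R :=
  BoundedOperator integral_op_subproof.

Lemma integral_operatorE mu A : 0 <= mu -> measurable A ->
  (integral_operator mu A)%:E = (\int[pos_part mu]_x g x A)%E.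
Proof.
move=> mu0 mA.
rewrite [X in X%:E](_ : _ = signed_of (mixture (pos_part mu)) A
  - signed_of (mixture (neg_part mu)) A); last by [].
rewrite EFinB !signed_ofE ?mixture_lty ?pos_part_lty ?neg_part_lty//.
rewrite !mixtureE.
(* On measurable sets [neg_part mu] vanishes, so integrating against it is integrating against
   [mzero]. *)
rewrite [X in (_ - X)%E](_ : _ = (\int[mzero]_x g x A)%E).
  by rewrite integral_measure_zero sube0.
by apply: eq_measure_integral => B mB _; rewrite ge0_neg_part.
Qed.

End integral_operator.

(** * A domination criterion for kernel operators *)

Section domination.
Context (d : measure_display) (X : measurableType d) (R : realType).
Local Notation M := (signed_measure X R).
Local Notation operator := (bounded_operator X R).
Implicit Types (A : set X) (mu nu : M) (S T F G U : operator).

Lemma bounded_operator_leP S T :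
  reflect (forall mu A, 0 <= mu -> S mu A <= T mu A) (S <= T).
Proof.
apply: (iffP (@asboolP (forall mu, 0 <= mu -> S mu <= T mu))) => ST mu.
  by move=> A /ST /signed_measure_leP; exact.
move=> mu0. by apply/signed_measure_leP => A; exact: ST.
Qed.

(** Its use: disjointness of [S] from 0 already provides a modulus of [S]. *)
Lemma finite_rank0 : finite_rank (0 : operator).
Proof.
exists 0%N, (fun=> fun=> 0), (fun=> 0).
by split=> [[]//|mu]; rewrite big_ord0.
Qed.

Lemma signed_measure_sum (I : Type) (r : seq I) (f : I -> M) A :
  (\sum_(i <- r) f i) A = \sum_(i <- r) f i A.
Proof.
elim: r => [|i r IH]; first by rewrite !big_nil.
by rewrite !big_cons -IH.
Qed.

Lemma ler_norm_tv_norm mu A : measurable A -> `|mu A| <= `|mu|.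
Proof.
move=> mA; have [mu0 _ _] := signed_measureP mu.
have := le_tv_norm mu mA measurable0 (setI0 A).
have := le_tv_norm mu measurable0 mA (set0I A).
by rewrite mu0 subr0 sub0r => ? ?; rewrite ler_norml lerNl; exact/andP.
Qed.

(** Evaluations at measurable sets are functionals of norm at most 1. *)
Lemma ex_finite_rank n (W : 'I_n -> set X) (nu : 'I_n -> M) :
  (forall i, measurable (W i)) ->
  exists2 F : operator, finite_rank F &
    forall mu, F mu = \sum_(i < n) mu (W i) *: nu i.
Proof.
move=> mW; pose f mu : M := \sum_(i < n) mu (W i) *: nu i.
have fP : f \in @bounded_operator_pred d X R.
  apply/asboolP; split=> [a mu mu'|].
    rewrite /f scaler_sumr -big_split; apply: eq_bigr => i _ /=.
    transitivity ((a * mu (W i) + mu' (W i)) *: nu i); first by [].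
    by rewrite scalerDl scalerA.
  exists (\sum_(i < n) `|nu i|) => mu.
  rewrite mulr_suml (le_trans (ler_norm_sum _ _ _))// ler_sum// => i _.
  by rewrite normrZ mulrC ler_wpM2l// ler_norm_tv_norm.
exists (BoundedOperator fP) => //.
exists n, (fun i mu => mu (W i)), nu; split=> // i; split=> //.
by exists 1 => mu; rewrite mul1r ler_norm_tv_norm.
Qed.

Lemma kernel_operator_dominated T :
  (forall mu, 0 <= mu -> 0 <= T mu) ->
  (forall mu (e : R), 0 <= mu -> 0 < e -> exists F G, [/\ finite_rank F,
    0 <= G, T <= F + G & forall A, measurable A -> G mu A <= e]) ->
  kernel_operator T.
Proof.
move=> T0 TFG S Sperp.
have T_ge0 mu A : 0 <= mu -> 0 <= T mu A.
  by move=> /T0 /signed_measure_leP; exact.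
have [b [_ [modb _ _]]] := Sperp _ finite_rank0.
have [ubb lbb] := modb.
(* [b] dominates both [S] and [- S], whose sum is 0. *)
have b_ge0 mu A : 0 <= mu -> 0 <= b mu A.
  move=> mu0.
  have /bounded_operator_leP/(_ mu A mu0) Sb := ubb S (or_introl erefl).
  have /bounded_operator_leP/(_ mu A mu0) := ubb (- S) (or_intror erefl).
  rewrite [leLHS](_ : _ = - S mu A)// => NSb.
  have := lerD Sb NSb; rewrite subrr -mulr2n.
  by rewrite pmulrn_lge0.
(* [T] is positive, hence its own modulus. *)
exists T, b; split=> //.
  split=> [y [->|->] //|y]; last by apply; left.
  apply/bounded_operator_leP => mu A mu0.
  by rewrite [leLHS](_ : _ = - T mu A)// ge0_cp// T_ge0.
split.
  move=> y [->|->]; apply/bounded_operator_leP => mu A mu0.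
    exact: T_ge0.
  exact: b_ge0.
move=> U lbU; have UT := lbU T (or_introl erefl).
have Ub := lbU b (or_intror erefl).
apply/bounded_operator_leP => mu A mu0; rewrite [leRHS](_ : _ = 0)//.
have [mA|nmA] := pselect (measurable A); last first.
  by have [_ _ ->//] := signed_measureP (U mu).
apply/ler_addgt0Pl => e e0; rewrite addr0.
have [F [G [Ffin G0 TleFG Gmu]]] := TFG mu e mu0 e0.
suff : U <= G.
  by move=> /bounded_operator_leP/(_ mu A mu0)/le_trans; apply; exact: Gmu.
(* [b'] is again a modulus of [S], and [c] one of [F]; their infimum is 0, and [b <= b'] by
   minimality of [b]. *)
have [b' [c [[ubb' _] [ubc _] [_ lb0]]]] := Sperp F Ffin.
have bb' : b <= b' by exact: lbb.
have Fc : F <= c by apply: ubc; left.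
(* [U - G] is below [b] since [G] is positive, and below [F] since [U <= T <= F + G]. *)
have : U - G <= 0.
  apply: lb0 => y [->|->].
    apply: le_trans bb'; apply/bounded_operator_leP => nu B nu0.
    move/bounded_operator_leP/(_ nu B nu0) : Ub.
    move/bounded_operator_leP/(_ nu B nu0) : G0.
    rewrite [(U - G) nu B](_ : _ = U nu B - G nu B)// [leLHS](_ : _ = 0)//.
    by move=> G0 Ub; rewrite lerBlDr ler_wpDr.
  apply: le_trans Fc; apply/bounded_operator_leP => nu B nu0.
  move/bounded_operator_leP/(_ nu B nu0) : UT.
  move/bounded_operator_leP/(_ nu B nu0) : TleFG.
  rewrite [(U - G) nu B](_ : _ = U nu B - G nu B)//.
  rewrite [leRHS](_ : _ = F nu B + G nu B)//.
  by move=> TFGnu UTnu; rewrite lerBlDr; exact: le_trans TFGnu.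
move=> /bounded_operator_leP UG; apply/bounded_operator_leP => nu B nu0.
have := UG nu B nu0.
by rewrite [leLHS](_ : _ = U nu B - G nu B)// [leRHS](_ : _ = 0)// subr_le0.
Qed.

End domination.

(** * Measurability through maps into the natural numbers *)

Section nat_valued.
Context (d : measure_display) (X : measurableType d).

(** Take the least index: the preimage of [n] is [V n] minus the earlier [V i]. *)
Lemma measurable_first_index (V : nat -> set X) :
  (forall n, measurable (V n)) -> (forall x, exists n, V n x) ->
  exists f : X -> nat, (forall x, V (f x) x) /\
    forall n, measurable (f @^-1` [set n]).
Proof.
move=> mV covV.
have covVb x : exists n, `[< V n x >].
  by have [n ?] := covV x; exists n; exact/asboolP.
exists (fun x => ex_minn (covVb x)); split=> [x|n].
  by case: ex_minnP => n /asboolP.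
rewrite (_ : _ @^-1` _ = V n `\` \bigcup_(i in [set i | (i < n)%N]) V i).
  by apply: measurableD => //; apply: bigcup_measurable.
apply/seteqP; split=> [x /=|x [Vnx Vx] /=].
  case: ex_minnP => m /asboolP Vmx m_min <-; split=> // -[i /= im Vix].
  by move: im; rewrite ltnNge m_min//; exact/asboolP.
case: ex_minnP => m /asboolP Vmx m_min; apply/eqP.
rewrite eqn_leq m_min /=; last exact/asboolP.
by rewrite leqNgt; apply/negP => mn; apply: Vx; exists m.
Qed.

(** For arbitrary [phi], a preimage is a countable union of intersections of level sets. This suits
    [excess], whose Hahn set is chosen separately for each pair of points. *)
Lemma measurable_fun_nat2 (d' : measure_display) (Y : measurableType d')
    (f g : X -> nat) (phi : nat -> nat -> Y) :
  (forall n, measurable (f @^-1` [set n])) ->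
  (forall n, measurable (g @^-1` [set n])) ->
  measurable_fun setT (fun x => phi (f x) (g x)).
Proof.
move=> mf mg _ B mB; rewrite setTI.
rewrite (_ : _ @^-1` _ = \bigcup_m \bigcup_(n in [set n | B (phi m n)])
    (f @^-1` [set m] `&` g @^-1` [set n])).
  apply: bigcup_measurable => m _; apply: bigcup_measurable => n _.
  exact: measurableI.
apply/seteqP; split=> [x Bx|x [m _ [n Bmn [/= -> ->]]]]//.
by exists (f x) => //; exists (g x).
Qed.

End nat_valued.

(** * Variation distance between the values of a Markovian kernel *)

Section approximation.
Context (d : measure_display) (X : measurableType d) (R : realType).
Local Notation M := (signed_measure X R).
Local Notation measure := {measure set X -> \bar R}.
Variable (k : R.-pker X ~> X).

Lemma kernel_fin x A : measurable A -> k x A = (fine (k x A))%:E.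
Proof.
by move=> mA; rewrite fineK// lty_fin_num_fun// prob_kernel ltry.
Qed.

(** Up to a factor 2, a bound on the total variation distance. The inequality is non-strict so that
    continuity of every k(., A) makes the set of such [x] closed. *)
Definition tv_close (e : R) (x y : X) := forall A, measurable A ->
  `|fine (k x A) - fine (k y A)| <= e.

Definition excess (x y : X) : measure :=
  pos_part (signed_of (k x) - signed_of (k y)).

Let signed_of_kE x A : measurable A -> signed_of (k x) A = fine (k x A).
Proof.
move=> mA; apply: EFin_inj.
by rewrite signed_ofE// -?kernel_fin// prob_kernel ltry.
Qed.

Lemma le_excess x y A : measurable A -> (k x A <= k y A + excess x y A)%E.
Proof.
move=> mA; have := pos_neg_partE (signed_of (k x) - signed_of (k y)) mA.
rewrite signed_measureB !signed_of_kE// EFinB -!kernel_fin// -/(excess x y).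
move=> kxy; rewrite addeC -leeBlDr ?kxy.
  by rewrite leeBlDr ?leeDl// fin_num_measure.
by rewrite kernel_fin.
Qed.

(** The mass of the positive part is the value of the difference on the positive Hahn set, so
    closeness is tested on that one set. *)
Lemma excess_le e x y : tv_close e x y -> (excess x y setT <= e%:E)%E.
Proof.
move=> xy; rewrite /excess pos_part_hahn// setTI lee_fin signed_measureB.
have [[mP _] _ _ _] := hahn_setsP (signed_of (k x) - signed_of (k y)).
by rewrite !signed_of_kE// (le_trans (ler_norm _))// xy.
Qed.

End approximation.

(** * Kernels approximated in variation along a sequence of points *)

Section separable_kernel.
Context (d : measure_display) (X : measurableType d) (R : realType).
Local Notation M := (signed_measure X R).
Local Notation measure := {measure set X -> \bar R}.
Variables (k : R.-pker X ~> X) (D : nat -> X).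
Hypothesis measurable_close :
  forall e n, measurable [set x | tv_close k e x (D n)].
Hypothesis dense_close : forall e x, 0 < e -> exists n, tv_close k e x (D n).

Section remainder.
Variables (e : R) (e_gt0 : 0 < e).

(** Two consecutive tolerances add up to at most the weight of index [j.+1] in [epsilon_trick]. *)
Let tol (j : nat) : R := e / (2 ^ j.+2)%:R / 2.

Let tol_gt0 j : 0 < tol j.
Proof. by rewrite !divr_gt0// ltr0n expn_gt0. Qed.

Let tolS j : tol j.+1 + tol j <= e / (2 ^ j.+2)%:R.
Proof.
rewrite [leRHS]splitr lerD2r /tol ler_pM2r// ler_pM2l//.
by rewrite lef_pV2 ?posrE ?ltr0n ?expn_gt0// ler_nat leq_pexp2l.
Qed.

Let tol_small eta : 0 < eta -> exists j, tol j <= eta.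
Proof.
move=> eta0; pose j := Num.bound (e / eta); exists j.
have ej : e / eta < j%:R by apply: archi_boundP; rewrite divr_ge0// ltW.
rewrite /tol ler_pdivrMr// ler_pdivrMr ?ltr0n ?expn_gt0//.
rewrite -mulrA mulrC -ler_pdivrMr//.
apply: le_trans (ltW ej) _; rewrite -natrM ler_nat.
have : (j < 2 ^ j.+2)%N by apply: leq_trans (ltn_expl _ _); [exact: ltnW|].
by move=> /ltnW /leq_trans; apply; exact: leq_pmull.
Qed.

Let ex_index j := measurable_first_index (measurable_close (tol j))
  (fun x => dense_close x (tol_gt0 j)).

(** In the notation of the overview, p_j x is [D (approx_index j x)] and t_j is [tol j]. *)
Definition approx_index j : X -> nat := projT1 (cid (ex_index j)).

Let indexP j x : tv_close k (tol j) x (D (approx_index j x)).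
Proof. by have [+ _] := projT2 (cid (ex_index j)); apply. Qed.

Lemma measurable_approx_index j n : measurable (approx_index j @^-1` [set n]).
Proof. by have [_] := projT2 (cid (ex_index j)); apply. Qed.

(** Triangle inequality through [k x]. *)
Let index_close j x :
  tv_close k (e / (2 ^ j.+2)%:R)
    (D (approx_index j.+1 x)) (D (approx_index j x)).
Proof.
move=> A mA; apply: le_trans (tolS j).
rewrite -(subrKA (fine (k x A))) (le_trans (ler_normD _ _))// lerD//.
  by rewrite distrC indexP.
exact: indexP.
Qed.

(** Term 0 is the part of k(p_0 x, .) missing from the finite rank operator; term [j.+1] pays for
    the step from p_j x to p_{j+1} x. *)
Definition remainder_term N x i : measure :=
  if i is j.+1 then excess k (D (approx_index j.+1 x)) (D (approx_index j x))
  else if (N <= approx_index 0 x)%N then k (D (approx_index 0 x)) else mzero.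

Definition remainder N x : measure := mseries (remainder_term N x) 0.

Lemma measurable_remainder N A : measurable A ->
  measurable_fun setT (fun x => remainder N x A).
Proof.
move=> mA; apply: ge0_emeasurable_sum => // -[|j] _ /=.
  (* Term 0 depends on one index only, which is passed twice. *)
  exact: (@measurable_fun_nat2 _ _ _ _ (approx_index 0) (approx_index 0)
    (fun m _ => (if (N <= m)%N then k (D m) else mzero : measure) A)
    (measurable_approx_index 0) (measurable_approx_index 0)).
exact: (@measurable_fun_nat2 _ _ _ _ (approx_index j.+1) (approx_index j)
  (fun m n => excess k (D m) (D n) A)
  (measurable_approx_index j.+1) (measurable_approx_index j)).
Qed.

Lemma remainder_le N x :
  (remainder N x setT <=
    (\1_[set x | (N <= approx_index 0 x)%N] x)%:E + e%:E)%E.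
Proof.
pose c : \bar R := (\1_[set x | (N <= approx_index 0 x)%N] x)%:E.
(* [h] puts the indicator at index 0; the budget [e / 2 ^ i.+1] added at index [i] bounds the
   excesses. *)
pose h i : \bar R := if i is 0%N then c else 0%E.
have h0 i : (0 <= h i)%E by case: i => [|i]//=; rewrite lee_fin.
have hE : (\sum_(0 <= i <oo) h i = c)%E.
  by rewrite nneseries_recl// eseries0 ?adde0// => -[].
rewrite -/c -hE; apply: le_trans (epsilon_trick xpredT h0 (ltW e_gt0)).
apply: lee_nneseries => [i _ _|[|j] _]; first exact: measure_ge0.
  have e2 : 0 <= e / (2 ^ 1)%:R by rewrite divr_ge0// ltW.
  rewrite /remainder_term /h /c indicE; case: ifPn => Nx.
    by rewrite mem_set// prob_kernel -EFinD lee_fin lerDl.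
  by rewrite memNset ?add0e ?lee_fin//; exact/negP.
by rewrite /= add0e excess_le//; exact: index_close.
Qed.

(** Equals k(p_0 x, A) if [approx_index 0 x] is below [N], and 0 otherwise: the kernel of the finite
    rank operator. *)
Definition simple_part N A x : \bar R := (\sum_(n < N)
  (fine (k (D n) A))%:E * (\1_(approx_index 0 @^-1` [set (n : nat)]) x)%:E)%E.

Lemma simple_part_ge0 N A x : (0 <= simple_part N A x)%E.
Proof. exact: sume_ge0. Qed.

Lemma measurable_simple_part N A : measurable_fun setT (simple_part N A).
Proof.
apply: emeasurable_sum => n; apply: measurable_funeM.
apply/measurable_EFinP; apply: measurable_indic.
exact: measurable_approx_index.
Qed.

Lemma integral_simple_part (m : measure) N A :
  (\int[m]_x simple_part N A x =
   \sum_(n < N) (fine (k (D n) A))%:E *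
     m (approx_index 0 @^-1` [set (n : nat)]))%E.
Proof.
have m1 n : measurable_fun setT
    (fun x => (\1_(approx_index 0 @^-1` [set n]) x)%:E : \bar R).
  apply/measurable_EFinP; apply: measurable_indic.
  exact: measurable_approx_index.
rewrite ge0_integral_sum//; last by move=> n; exact: measurable_funeM.
apply: eq_bigr => n _; rewrite ge0_integralZl_EFin//.
by rewrite integral_indic ?setIT//; exact: measurable_approx_index.
Qed.

Lemma kernel_le_remainder N x A : measurable A ->
  (k x A <= simple_part N A x + remainder N x A)%E.
Proof.
move=> mA.
have first_term : (k (D (approx_index 0 x)) A <=
    simple_part N A x + remainder_term N x 0 A)%E.
  have [Nx|xN] := leqP N (approx_index 0 x).
    by rewrite /= Nx leeDr// simple_part_ge0.
  rewrite /= leqNgt xN adde0 /simple_part (bigD1 (Ordinal xN))//=.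
  by rewrite indicE mem_set// mule1 -kernel_fin// leeDl// sume_ge0.
(* Telescoping: the step from p_J x to p_{J+1} x costs one excess. *)
have chain J : (k (D (approx_index J x)) A <=
    simple_part N A x + \sum_(0 <= i < J.+1) remainder_term N x i A)%E.
  elim: J => [|J IH]; first by rewrite big_nat1.
  rewrite big_nat_recr//= addeA.
  by apply: le_trans (le_excess _ _ (D (approx_index J x)) mA) _; exact: leeD2r.
(* Stop the chain at an index with tolerance at most [eta], and bound the partial sum by the whole
   series. *)
apply/lee_addgt0Pr => eta /tol_small[J Jeta].
apply: (@le_trans _ _ (k (D (approx_index J x)) A + eta%:E)%E).
  rewrite (kernel_fin k x mA) (kernel_fin k (D _) mA) -EFinD lee_fin -lerBlDl.
  by rewrite (le_trans (ler_norm _))// (le_trans (@indexP J x A mA)).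
rewrite leeD2r// (le_trans (chain J))// leeD2l//.
exact: nneseries_lim_ge.
Qed.

End remainder.
Lemma induced_by_ge0E (T : bounded_operator X R) (mu : M) A :
  induced_by T k -> 0 <= mu -> measurable A ->
  (T mu A)%:E = (\int[pos_part mu]_x k x A)%E.
Proof.
move=> Tk mu0 mA; rewrite Tk//.
rewrite [X in (_ - X)%E](_ : _ = (\int[mzero]_x k x A)%E).
  by rewrite integral_measure_zero sube0.
by apply: eq_measure_integral => B mB _; rewrite ge0_neg_part.
Qed.

Lemma induced_by_kernel_operator (T : bounded_operator X R) :
  induced_by T k -> kernel_operator T.
Proof.
move=> Tk; apply: kernel_operator_dominated => [mu mu0|mu e mu0 e0].
  apply/signed_measure_leP => A; rewrite [leLHS](_ : _ = 0)//.
  have [mA|nmA] := pselect (measurable A); last first.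
    by have [_ _ ->//] := signed_measureP (T mu).
  by rewrite -lee_fin induced_by_ge0E// integral_ge0.
have muT0 : 0 <= mu setT by move/signed_measure_leP : mu0 => /(_ setT).
(* Makes the integral of the constant [eps] at most [e / 2]; the summand 1 avoids dividing by 0 when
   [mu] is 0. *)
pose eps := e / 2 / (mu setT + 1).
have eps0 : 0 < eps by rewrite !divr_gt0// ltr_wpDl.
pose E N := [set x | (N <= approx_index eps0 0 x)%N].
have mE N : measurable (E N).
  rewrite (_ : E N = \bigcup_(n in [set n | (N <= n)%N])
      approx_index eps0 0 @^-1` [set n]).
    by apply: bigcup_measurable => n _; exact: measurable_approx_index.
  apply/seteqP; split=> [x Nx|x [n /= Nn xn]].
    by exists (approx_index eps0 0 x).
  by rewrite /E /= xn.
(* Every index is finite, so the [E N] decrease to the empty set, and continuity from above applies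
   to the finite measure [pos_part mu]. *)
have [N EN] : exists N, mu (E N) <= e / 2.
  have capE : \bigcap_N E N = set0.
    rewrite -subset0 => x /(_ (approx_index eps0 0 x).+1 I).
    by rewrite /E/= ltnn.
  have e20 : 0 < e / 2 by rewrite divr_gt0.
  have : pos_part mu (E N) @[N --> \oo] --> pos_part mu (\bigcap_N E N).
    apply: nonincreasing_cvg_mu => //.
    - by rewrite ltey_eq fin_num_measure.
    - by rewrite capE.
    - by move=> m n mn; apply/subsetPset => x; exact: leq_trans.
  rewrite capE measure0 => /fine_cvgP[_].
  move=> /cvgrPdist_lt/(_ _ e20)[N _ /(_ N (leqnn N))].
  rewrite /= sub0r normrN => /ltW /(le_trans (ler_norm _)).
  by rewrite ge0_pos_part//; exists N.
have [F Ffin FE] := ex_finite_rank (n := N)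
  (W := fun n => approx_index eps0 0 @^-1` [set (n : nat)])
  (fun n => signed_of (k (D n))) (fun n => measurable_approx_index eps0 0 n).
have gC x : (remainder eps0 N x setT <= (1 + eps)%:E)%E.
  apply: le_trans (remainder_le eps0 N x) _.
  by rewrite EFinD leeD2r// lee_fin indicE; case: (_ \in _).
have mg := measurable_remainder eps0 N.
exists F, (integral_operator mg gC); split=> //.
- apply/bounded_operator_leP => nu A nu0; rewrite [leLHS](_ : _ = 0)//.
  have [mA|nmA] := pselect (measurable A); last first.
    by have [_ _ ->//] := signed_measureP (integral_operator mg gC nu).
  by rewrite -lee_fin integral_operatorE// integral_ge0.
- apply/bounded_operator_leP => nu A nu0.
  rewrite [leRHS](_ : _ = F nu A + integral_operator mg gC nu A)//.
  have [mA|nmA] := pselect (measurable A); last first.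
    have out (la : M) : la A = 0 by have [_ _ ->] := signed_measureP la.
    by rewrite !out addr0.
  rewrite -lee_fin EFinD integral_operatorE// induced_by_ge0E//.
  (* Integrate the pointwise bound; the simple part contributes [F nu A]. *)
  apply: le_trans (ge0_le_integral _ measurableT _ _ _
    (fun x _ => kernel_le_remainder eps0 N x mA)) _ => //.
  - exact: measurable_kernel.
  - by apply: emeasurable_funD; [exact: measurable_simple_part|exact: mg].
  rewrite ge0_integralD//; last 3 first.
    by move=> x _; exact: simple_part_ge0.
    exact: measurable_simple_part.
    exact: mg.
  rewrite leeD2r// integral_simple_part FE signed_measure_sum -sumEFin.
  apply: lee_sum => n _; have mI := measurable_approx_index eps0 0 n.
  rewrite ge0_pos_part// signed_measureZ EFinM.
  rewrite signed_ofE ?prob_kernel ?ltry//.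
  by rewrite -kernel_fin// muleC.
- move=> A mA; rewrite -lee_fin integral_operatorE//.
  have m1E : measurable_fun setT (fun x => (\1_(E N) x)%:E : \bar R).
    by apply/measurable_EFinP; exact: measurable_indic.
  (* This integral is [mu (E N) + eps * mu setT], with both summands at most [e / 2]. *)
  apply: (@le_trans _ _ (\int[pos_part mu]_x ((\1_(E N) x)%:E + eps%:E))%E).
    apply: ge0_le_integral => //.
    - exact: mg.
    - exact: emeasurable_funD.
    - move=> x _; apply: le_trans (remainder_le eps0 N x).
      by apply: le_measure; rewrite ?inE.
  rewrite ge0_integralD//; last by move=> x _; rewrite lee_fin ltW.
  rewrite integral_indic// setIT integral_cst// !ge0_pos_part// -EFinM -EFinD.
  rewrite lee_fin [leRHS]splitr lerD// /eps mulrAC ler_pdivrMr ?ltr_wpDl//.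
  by rewrite ler_pM2l ?divr_gt0// lerDl.
Qed.

End separable_kernel.

(** * Variation closeness under the Feller properties *)

Section feller_kernels.
Context (X : ptopologicalType) (R : realType).
Variable k : R.-pker (borel X) ~> (borel X).

Lemma kernel_adjoint_indic (A : set (borel X)) x : measurable A ->
  kernel_adjoint k (\1_A) x = fine (k x A).
Proof.
by move=> mA; rewrite /kernel_adjoint /Rintegral integral_indic// setIT.
Qed.

(** With indicators as test functions in the unit ball, strong Feller gives continuity of each k(.,
    A), and ultra Feller gives it uniformly in [A]. *)
Lemma bounded_measurable_indic (A : set (borel X)) : measurable A ->
  bounded_measurable (\1_A : borel X -> R) /\
  forall x, `|\1_A x : R| <= 1.
Proof.
move=> mA; have le1 x : `|\1_A x : R| <= 1.
  by rewrite indicE; case: (_ \in _); rewrite ?normr1 ?normr0.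
by split=> //; split; [exact: measurable_indic|exists 1].
Qed.

(** The set is an intersection over all measurable [A], possibly uncountable; it is measurable
    because each member is closed, by continuity of k(., A). *)
Lemma strong_feller_measurable_close e y : strong_feller_kernel k ->
  measurable [set x : borel X | tv_close k e x y].
Proof.
move=> kF; rewrite -[X in measurable X]setCK; apply: measurableC.
apply: sub_sigma_algebra; apply: closed_openC.
rewrite (_ : [set _ | _] = \bigcap_(A in [set A : set (borel X) | measurable A])
    [set x : X | `|fine (k x A) - fine (k y A)| <= e]); last first.
  by apply/seteqP; split=> x xy A; exact: xy.
apply: closed_bigI => A mA.
have [kA _] := kF _ (bounded_measurable_indic mA).1.
rewrite (_ : [set _ | _] =
    (fun x => `|kernel_adjoint k (\1_A) x - fine (k y A)|) @^-1`
      [set r | r <= e]).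
  apply: closed_comp => [x _|]; last exact: closed_le.
  apply: cvg_norm; apply: cvgB; [exact: kA|exact: cvg_cst].
by apply/seteqP; split=> x /=; rewrite kernel_adjoint_indic.
Qed.

(** Equicontinuity on the unit ball, tested on indicators, gives an open set around [x] on which
    every k(., A) stays within [e] of k(x, A); it meets [S]. *)
Lemma ultra_feller_dense_close (S : set X) e (x : X) : dense S ->
  ultra_feller_kernel k -> 0 < e -> exists2 y, S y & tv_close k e x y.
Proof.
move=> dS [_ /(_ 1 ltr01) ek] e0.
have := ek x _ (entourage_ball _ (PosNum e0)).
rewrite /prop_near1 nbhsE => -[V [oV Vx] Vclose].
have [y [Vy Sy]] := dS V (ex_intro _ x Vx) oV.
exists y => // A mA; have [bA A1] := bounded_measurable_indic mA.
have := Vclose y Vy _ (conj bA A1).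
by rewrite /= !kernel_adjoint_indic// => /ltW.
Qed.

End feller_kernels.

(** Numbers that code no element of [A] are sent to [point]; hence only an inclusion, which also
    covers the empty [A]. *)
Lemma countable_range (T : pointedType) (A : set T) : countable A ->
  exists f : nat -> T, A `<=` range f.
Proof.
move=> /countable_injP[g ginj].
exists (fun n => xget point [set x | A x /\ g x = n]) => x Ax.
exists (g x) => //.
by case: xgetP => [y _ [Ay gyx]|/(_ x)]; [apply: ginj; rewrite ?inE|case].
Qed.

Theorem theorem2p6 (R : realType) (Omega : ptopologicalType)
  (polish_Omega : polish R Omega) (T : bounded_operator (borel Omega) R)
  (T_ultra_feller : ultra_feller T) :
  kernel_operator T.
Proof.
have [[S /countable_range[D SD] dS] _] := polish_Omega.
have [k [Tk kU]] := T_ultra_feller.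
apply: (induced_by_kernel_operator (k := k) (D := D)) => // [e n|e x e0].
  by apply: strong_feller_measurable_close; case: kU.
have [y /SD[n _ <-] xy] := ultra_feller_dense_close x dS kU e0.
by exists n.
Qed.
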